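(* Let $f$ be a positive strictly convex function on $[0,1]$ with $f(0)=0$, $f(1)=1$ and $f'(1)<\infty$, and therefore $1<f'(1)<\infty$. Consider the system described in the context, in which the POIs are visited according to the policy $$\pi_i(\vec r)=f(P_i)-f(P_{i-1}),\qquad i\ge1,\qquad P_i=\frac{1}{r(1)}\sum_{j=1}^ir_j,\quad P_0=0.$$ Then the system is ergodic if, and only if, $$\frac{\alpha\,\theta'(1)}{\lambda\,\varphi'(1)}\le\frac{1}{f'(1)-1}.$$
   Context: Parameters: $\lambda,\alpha>0$, $\mu>0$; $\{\varphi_k,k\ge1\}$ and $\{\theta_k,k\ge1\}$ are proper probability distributions on the positive integers, $\theta_0=0$, with generating functions $\varphi(z)=\sum_{i\ge1}\varphi_iz^i$ and $\theta(z)=\sum_{i\ge0}\theta_iz^i$. Standing assumption: $\theta'(1)\,\varphi'(1)<\infty$. Put $\frac{1-\theta(z)}{1-z}=\sum_{n\ge0}\Theta_nz^n$ and $\frac{1-\varphi(z)}{1-z}=\sum_{n\ge0}\Phi_nz^n$. The dynamical system $\vec r(t)=(r_i(t))_{i\ge1}$ of non-negative sequences ($r_i$ is the number per player of points of interest, POIs, with score $i$) is governed by $$\frac{\mathrm{d}r_i(t)}{\mathrm{d}t}=\lambda\varphi_i+\mu\bigl[r_{i+1}(t)-r_i(t)\bigr]+\alpha\Bigl[\sum_{j=0}^{i}\theta_j\,\pi_{i-j}(\vec r(t))-\pi_i(\vec r(t))\Bigr],\qquad i\ge1,$$ with $\pi_0(\cdot)=0$, where $\pi_i(\vec r)$ is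 the probability that the visited POI has score $i$. Here $r(1)=\sum_{i\ge1}r_i$, so $P_i$ is the proportion of POIs with score at most $i$, and $f(P_i)$ is the probability of selecting a POI with score at most $i$. A stationary regime $\vec r=(r_i)_{i\ge1}$ satisfies $$r_{n+1}=\frac{\alpha}{\mu}\sum_{i=0}^{n-1}\pi_{n-i}(\vec r)\,\Theta_i+\frac{\lambda}{\mu}\Phi_n,\qquad n\ge0 .$$ Ergodicity: the system is called ergodic if it has a finite stationary regime $\vec r$ such that $r(1)=\sum_{i\ge1}r_i<\infty$ and $\overline{\pi}=\sum_{i\ge1}\pi_i(\vec r)=1$. *)

(* Defs.v *)
From HB Require Import structures.
From mathcomp Require Import all_boot all_order all_algebra.
From mathcomp Require Import all_classical all_reals all_analysis.

Set Implicit Arguments.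
Unset Strict Implicit.
Unset Printing Implicit Defensive.

Import Order.TTheory GRing.Theory Num.Theory.
Import numFieldNormedType.Exports.

Local Open Scope classical_set_scope.
Local Open Scope ring_scope.

Definition strictly_convex_on (R : realType) (a b : R) (f : R -> R) : Prop :=
  forall x y t : R, a <= x <= b -> a <= y <= b -> x != y -> 0 < t < 1 ->
    f (t * x + (1 - t) * y) < t * f x + (1 - t) * f y.

(* The functions differentiated at 1 are only meaningful on [0, 1] (or only
   convergent there), so g'(1) is the one-sided derivative. *)
Definition left_quotient (R : realType) (g : R -> R) (x z : R) : R :=
  (g z - g x) / (z - x).

(* For g convex the quotient has a limit in ]-oo, +oo], so this says
   "g'(x) < +oo". *)
Definition left_derivable (R : realType) (g : R -> R) (x : R) : Prop :=
  cvg (left_quotient g x z @[z --> x^'-]).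

Definition left_derive (R : realType) (g : R -> R) (x : R) : R :=
  lim (left_quotient g x z @[z --> x^'-]).

Definition proper_distribution (R : realType) (p : nat -> R) : Prop :=
  [/\ p 0%N = 0, forall i, 0 <= p i & series p @ \oo --> (1 : R)].

Definition generating_function (R : realType) (p : nat -> R) (z : R) : R :=
  limn (pseries p z).

(* Sequences (r_i)_{i >= 1} are encoded as r : nat -> R; the value r 0 is
   never used. *)
Definition partial_sum (R : realType) (r : nat -> R) (n : nat) : R :=
  \sum_(1 <= i < n.+1) r i.

Definition total (R : realType) (r : nat -> R) : R := limn (partial_sum r).

Definition proportion (R : realType) (r : nat -> R) (i : nat) : R :=
  partial_sum r i / total r.

Definition policy (R : realType) (f : R -> R) (r : nat -> R) (i : nat) : R :=
  if i is i'.+1 then f (proportion r i) - f (proportion r i') else 0.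

Definition drift (R : realType) (lambda mu alpha : R) (phi theta : nat -> R)
    (pi_ : (nat -> R) -> nat -> R) (r : nat -> R) (i : nat) : R :=
  lambda * phi i + mu * (r i.+1 - r i) +
  alpha * (\sum_(0 <= j < i.+1) theta j * pi_ r (i - j)%N - pi_ r i).

Definition solution (R : realType) (lambda mu alpha : R) (phi theta : nat -> R)
    (pi_ : (nat -> R) -> nat -> R) (r : R -> nat -> R) : Prop :=
  forall (t : R) (i : nat), 0 < t -> (1 <= i)%N ->
    0 <= r t i /\
    is_derive t 1 (fun s => r s i)
      (drift lambda mu alpha phi theta pi_ (r t) i).

(* When r and pi_ r are summable, summing the equations over 1 <= i <= n and
   letting n tend to infinity forces mu * r 1 = lambda, hence the balance
   equations
   r (n + 1) = alpha / mu * sum_(i < n) pi_ r (n - i) * Theta i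
               + lambda / mu * Phi n,  n >= 0,
   where Theta n and Phi n are the tails sum_(k > n) of theta and phi. *)
Definition stationary_regime (R : realType) (lambda mu alpha : R)
    (phi theta : nat -> R) (pi_ : (nat -> R) -> nat -> R) (r : nat -> R)
    : Prop :=
  solution lambda mu alpha phi theta pi_ (fun _ : R => r).

Definition ergodic (R : realType) (lambda mu alpha : R) (phi theta : nat -> R)
    (pi_ : (nat -> R) -> nat -> R) : Prop :=
  exists r : nat -> R,
    [/\ stationary_regime lambda mu alpha phi theta pi_ r,
        cvgn (partial_sum r) &
        partial_sum (pi_ r) @ \oo --> (1 : R)].

(* Main.v *)
(** With b = lambda phi'(1), a = alpha theta'(1), Phi_n and Theta_n the tails
    of phi and theta and B_n = Phi_0 + ... + Phi_(n-1), summing the balance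
    equations over the scores gives r(1) = (a + b) / mu and
      (a + b) P_(n+1) = lambda B_(n+1) + alpha \sum_(j <= n) Theta_j f(P_(n-j)).
    This determines P from P_0 = 0, and a stationary regime can be read off P
    as soon as P tends to 1.  P is nondecreasing and stays below every fixed
    point of the convex map g(p) = (b + a f(p)) / (a + b), and its limit
    is a fixed point of g.  Since g(0) > 0 and g(1) = 1, strict convexity makes
    1 the only fixed point in [0, 1] exactly when g'(1) <= 1, that is
    a f'(1) <= a + b. *)
Require Import Defs.
From HB Require Import structures.
From mathcomp Require Import all_boot all_order all_algebra.
From mathcomp Require Import all_classical all_reals all_analysis.
From mathcomp Require Import ring lra zify.

Import Order.TTheory GRing.Theory Num.Theory.
Import numFieldNormedType.Exports.

Local Open Scope classical_set_scope.
Local Open Scope ring_scope.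

(** * Convolutions, and the tails of a sequence *)

Definition convol {R : realType} (u v : nat -> R) (n : nat) : R :=
  \sum_(0 <= j < n.+1) u j * v (n - j)%N.

(* For [p] equal to [phi] or [theta], the coefficient [Phi_n] or [Theta_n] of
   [(1 - p(z)) / (1 - z)]. *)
Definition survival {R : realType} (p : nat -> R) (n : nat) : R :=
  1 - series p n.+1.

Lemma cvg_half : n./2 @[n --> \oo] --> \oo.
Proof.
apply/cvgnyPge => A; exists A.*2 => //= n /= hn.
by rewrite -(doubleK A) half_leq.
Qed.

Lemma ler_convol {R : realType} (u v w : nat -> R) (n : nat) :
  (forall i, 0 <= u i) -> (forall j, (j <= n)%N -> v j <= w j) ->
  convol u v n <= convol u w n.
Proof.
move=> u0 vw; rewrite /convol; apply: ler_sum_nat => j hj.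
by apply: ler_wpM2l => //; apply: vw; rewrite leq_subr.
Qed.

Lemma convol_cst {R : realType} (u : nat -> R) (c : R) (n : nat) :
  convol u (fun=> c) n = series u n.+1 * c.
Proof. by rewrite /convol /series /= -mulr_suml. Qed.

(* Squeeze: half of the terms of the sum see a value of [v] of index at least
   [n./2]. *)
Lemma cvg_convol {R : realType} (u v : nat -> R) (a l : R) :
  (forall i, 0 <= u i) -> series u @ \oo --> a ->
  (forall i, 0 <= v i) -> nondecreasing_seq v -> v @ \oo --> l ->
  convol u v @ \oo --> a * l.
Proof.
move=> u0 ua v0 vmono vl.
have vle n : v n <= l.
  rewrite -(cvg_lim _ vl) //; apply: nondecreasing_cvgn_le => //.
  by apply/cvg_ex; exists l.
apply: (@squeeze_cvgr _ _ _ _ (fun n => series u n./2.+1 * v n./2)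
  (fun n => series u n.+1 * l)).
- apply: nearW => n; apply/andP; split; last first.
    by rewrite -convol_cst; apply: ler_convol.
  rewrite /convol /series /= mulr_suml.
  have hn : (n./2.+1 <= n.+1)%N by rewrite ltnS; lia.
  rewrite [leRHS](big_cat_nat (n := n./2.+1)) //= -[leLHS]addr0.
  apply: lerD; last by apply: sumr_ge0 => i _; apply: mulr_ge0.
  apply: ler_sum_nat => j hj; apply: ler_wpM2l => //; apply: vmono; lia.
- apply: cvgM; last by apply: (cvg_comp _ _ cvg_half vl).
  have : [sequence series u n.+1]_n @ \oo --> a by rewrite cvg_shiftS.
  by move=> /(cvg_comp _ _ cvg_half).
- apply: cvgMr_tmp.
  by have : [sequence series u n.+1]_n @ \oo --> a by rewrite cvg_shiftS.
Qed.

(** This is the coefficient of [z^(n+1)] in [(1 - z) S(z) v(z) = (1 - p(z)) v(z)], where [S]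
    generates [survival p]. *)
Lemma convol_survival {R : realType} (p v : nat -> R) (n : nat) :
  convol (survival p) v n.+1 = convol (survival p) v n + v n.+1 - convol p v n.+1.
Proof.
rewrite /convol !(@big_nat_recl _ _ _ n.+1) //= !subn0.
under eq_bigr => i _ do rewrite subSS.
under [X in _ = _ + _ - (_ + X)]eq_bigr => i _ do rewrite subSS.
have -> : \sum_(0 <= i < n.+1) survival p i.+1 * v (n - i)%N =
    \sum_(0 <= i < n.+1) survival p i * v (n - i)%N -
    \sum_(0 <= i < n.+1) p i.+1 * v (n - i)%N.
  rewrite -sumrB; apply: eq_bigr => i _.
  by rewrite /survival [series p i.+2]seriesSr; ring.
by rewrite /survival /series /= big_nat1; ring.
Qed.

(** Differencing commutes with convolution; the vanishing values at [0] remove the boundary term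
    [j = n + 1]. *)
Lemma convol_increment {R : realType} (p v w : nat -> R) (n : nat) :
  v 0%N = 0 -> w 0%N = 0 -> (forall k, w k.+1 = v k.+1 - v k) ->
  convol p w n.+1 = convol p v n.+1 - convol p v n.
Proof.
move=> v0 w0 wS; rewrite /convol !(@big_nat_recr _ _ _ n.+1) //= !subnn v0 w0.
rewrite !mulr0 !addr0 -sumrB !big_seq; apply: eq_bigr => i.
by rewrite mem_index_iota => /andP[_]; rewrite ltnS => hi; rewrite subSn // wS; ring.
Qed.

(** * The mean of a distribution as the sum of its tails *)

Section proper_distribution.
Context {R : realType} (p : nat -> R) (pd : proper_distribution p).

Lemma nondecreasing_series_distr : nondecreasing_seq (series p).
Proof.
by case: pd => _ p0 _; apply/nondecreasing_seqP => n; rewrite seriesSr lerDl.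
Qed.

Lemma series_distr_le1 n : series p n <= 1.
Proof.
case: pd => _ p0 p1; rewrite -(cvg_lim _ p1) //.
apply: nondecreasing_cvgn_le; first exact: nondecreasing_series_distr.
by apply/cvg_ex; exists 1.
Qed.

Lemma survival_ge0 n : 0 <= survival p n.
Proof. by rewrite subr_ge0 series_distr_le1. Qed.

Lemma nondecreasing_series_survival : nondecreasing_seq (series (survival p)).
Proof.
by apply/nondecreasing_seqP => n; rewrite seriesSr lerDl survival_ge0.
Qed.

(** Truncation of [(1 - z) S(z) = 1 - p(z)]; the last term is the remainder left by cutting at
    [N]. *)
Lemma pseries_survival z N : (1 - z) * pseries (survival p) z N =
  1 - pseries p z N - (1 - series p N) * z ^+ N.
Proof.
elim: N => [|N IH]; first by rewrite /pseries /series /= !big_geq // expr0; ring.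
rewrite /pseries !seriesSr -!/(pseries _ _) mulrDr IH /survival /= seriesSr exprS.
ring.
Qed.

Lemma pseries1 : pseries p 1 = series p.
Proof.
by apply/funext => n; apply: eq_bigr => i _ /=; rewrite expr1n mulr1.
Qed.

Lemma generating_function1 : generating_function p 1 = 1.
Proof.
by case: pd => _ _ p1; rewrite /generating_function pseries1; apply: cvg_lim.
Qed.

Lemma is_cvg_pseries z : 0 <= z <= 1 -> cvgn (pseries p z).
Proof.
case: pd => _ p0 p1 /andP[z0 z1]; apply: (series_le_cvg _ p0).
- by move=> n; rewrite mulr_ge0 ?exprn_ge0.
- by move=> n; rewrite ler_piMr ?exprn_ile1.
- by apply/cvg_ex; exists 1.
Qed.

(** The remainder of the truncated identity vanishes for [z < 1]. The derivative at [1] thus becomes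
    a limit of power series with non-negative coefficients. *)
Lemma cvg_pseries_survival z : 0 <= z < 1 ->
  pseries (survival p) z @ \oo --> left_quotient (generating_function p) 1 z.
Proof.
move=> /andP[z0 z1].
have z1' : 0 < 1 - z by rewrite subr_gt0.
have -> : pseries (survival p) z =
    fun N => (1 - z)^-1 * (1 - pseries p z N - (1 - series p N) * z ^+ N).
  by apply/funext => N; rewrite -pseries_survival mulKf // gt_eqF.
have -> : left_quotient (generating_function p) 1 z =
    (1 - z)^-1 * (1 - generating_function p z - (1 - 1) * 0).
  rewrite /left_quotient generating_function1.
  by rewrite -(opprB 1 z) invrN mulrN -mulNr opprB subrr mul0r subr0 mulrC.
case: pd => _ p0 p1.
apply: cvgMl_tmp; apply: cvgB.
  by apply: cvgB; [exact: cvg_cst|apply: is_cvg_pseries; rewrite z0 ltW].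
apply: cvgM; first by apply: cvgB; [exact: cvg_cst|].
by apply: cvg_expr; rewrite ger0_norm.
Qed.

Hypothesis pm : left_derivable (generating_function p) 1.
Let m := left_derive (generating_function p) 1.

(** For [z < 1] a truncation is below the full series, which is the difference quotient; then [z]
    tends to [1]. *)
Lemma series_survival_le_mean N : series (survival p) N <= m.
Proof.
have mE : left_quotient (generating_function p) 1 z @[z --> 1^'-] --> m by [].
have sE : pseries (survival p) z N @[z --> 1^'-] --> series (survival p) N.
  have -> : series (survival p) N = pseries (survival p) 1 N.
    by apply: eq_bigr => i _ /=; rewrite expr1n mulr1.
  (* The truncation is a polynomial in [z], hence continuous at [1]. *)
  apply: cvg_at_left_filter; elim: N => [|N IH].
    by rewrite /pseries /series /=; under eq_fun do rewrite big_geq //;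
      rewrite big_geq //; exact: cvg_cst.
  rewrite /pseries; under eq_fun do rewrite seriesSr; rewrite seriesSr.
  by apply: cvgD => //; apply: cvgMl_tmp; exact: exprn_continuous.
apply: (ler_cvg_to sE mE).
near=> z.
have z1 : 0 <= z < 1.
  by apply/andP; split; near: z; [apply: nbhs_left_ge|apply: nbhs_left_lt].
have h := cvg_pseries_survival z z1.
rewrite -(cvg_lim _ h) //; apply: nondecreasing_cvgn_le; last first.
  by apply/cvg_ex; eexists; exact: h.
apply/nondecreasing_seqP => n; rewrite /pseries seriesSr lerDl mulr_ge0 ?survival_ge0//.
by rewrite exprn_ge0 //; case/andP: z1.
Unshelve. all: by end_near. Qed.

(** Interchange of the limits in [z] and [N]. The remaining bound holds because [z^i <= 1] puts
    every difference quotient below the sum of the tails. *)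
Lemma cvg_series_survival : series (survival p) @ \oo --> m.
Proof.
have c : cvgn (series (survival p)).
  apply: nondecreasing_is_cvgn; first exact: nondecreasing_series_survival.
  by exists m => _ [n _ <-]; exact: series_survival_le_mean.
suff -> : m = limn (series (survival p)) by [].
apply/eqP; rewrite eq_le; apply/andP; split; last first.
  by apply: limr_le => //; apply: nearW; exact: series_survival_le_mean.
apply: limr_le => //; near=> z.
have z1 : 0 <= z < 1.
  by apply/andP; split; near: z; [apply: nbhs_left_ge|apply: nbhs_left_lt].
apply: (cvgr_to_le (cvg_pseries_survival z z1)); apply: nearW => n.
apply: le_trans (nondecreasing_cvgn_le nondecreasing_series_survival c n).
apply: ler_sum => i _; rewrite ler_piMr ?survival_ge0 //.
by case/andP: z1 => z0 z1; rewrite exprn_ile1 // ltW.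
Unshelve. all: by end_near. Qed.

(** The first tail is already [1], since [p 0 = 0]. This makes the constants [a] and [b]
    positive. *)
Lemma mean_ge1 : 1 <= m.
Proof.
have := series_survival_le_mean 1.
rewrite /series /= big_nat1 /survival /series /= big_nat1.
by case: pd => -> _ _; rewrite subr0.
Qed.

End proper_distribution.

(** * Chords of a strictly convex function ending at 1 *)

Section convex.
Context {R : realType} (f : R -> R).
Hypotheses (f_pos : forall x : R, 0 < x <= 1 -> 0 < f x).
Hypotheses (f_convex : strictly_convex_on 0 1 f) (f0 : f 0 = 0) (f1 : f 1 = 1).

Lemma convex_ge0 (x : R) : 0 <= x <= 1 -> 0 <= f x.
Proof.
move=> /andP[]; rewrite le_eqVlt => /predU1P[<- _|x0 x1]; first by rewrite f0.
by rewrite ltW // f_pos // x0.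
Qed.

(** For [0 < x < y], the point [x] is a barycentre of [0] and [y], so [f x < (x / y) f y <= f y]. *)
Lemma convex_nondecreasing (x y : R) : 0 <= x -> x <= y -> y <= 1 -> f x <= f y.
Proof.
move=> x0; rewrite le_eqVlt => /predU1P[->//|xy] y1.
have [->|xn0] := eqVneq x 0; first by rewrite f0 convex_ge0 // y1 (le_trans x0) // ltW.
have {}x0 : 0 < x by rewrite lt_neqAle eq_sym xn0.
have y0 : 0 < y := lt_trans x0 xy.
have t01 : 0 < x / y < 1 by rewrite divr_gt0 // ltr_pdivrMr // mul1r.
have := f_convex y 0 (x / y); rewrite f0 mulr0 !addr0 lexx ler01 gt_eqF // (ltW y0) y1.
move=> /(_ isT isT isT t01); rewrite divfK ?gt_eqF // => h.
apply/ltW/(lt_le_trans h); apply: ler_piMl; first by rewrite convex_ge0 // ltW.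
by case/andP: t01 => _ /ltW.
Qed.

Lemma left_quotient_convexE (x : R) : x < 1 -> f x = 1 - left_quotient f 1 x * (1 - x).
Proof.
move=> x1; rewrite /left_quotient f1 -(opprB x 1) mulrN.
by rewrite divfK ?lt_eqF ?subr_lt0 //; ring.
Qed.

(** With [t = (1 - y) / (1 - x)], [y] is the barycentre [t x + (1 - t)]; strict convexity there
    compares the two chords. *)
Lemma left_quotient_increasing (x y : R) : 0 <= x -> x < y -> y < 1 ->
  left_quotient f 1 x < left_quotient f 1 y.
Proof.
move=> x0 xy y1; have x1 := lt_trans xy y1.
have dx : 0 < 1 - x by rewrite subr_gt0.
have dy : 0 < 1 - y by rewrite subr_gt0.
pose t := (1 - y) / (1 - x).
have tE : t * (1 - x) = 1 - y by rewrite divfK // gt_eqF.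
have t01 : 0 < t < 1 by rewrite divr_gt0 // ltr_pdivrMr // mul1r ltrD2l ltrN2.
have := f_convex x 1 t.
rewrite x0 (ltW x1) lexx ler01 lt_eqF // => /(_ isT isT isT t01).
have -> : t * x + (1 - t) * 1 = y by move: tE; lra.
rewrite f1 (left_quotient_convexE _ y1) (left_quotient_convexE _ x1) -tE.
set b := left_quotient _ _ _; set a := left_quotient _ _ _ => h.
have : 0 < (b - a) * (t * (1 - x)).
  by move: h; rewrite -subr_gt0; congr (_ < _); ring.
by rewrite tE pmulr_lgt0 // subr_gt0.
Qed.

Hypothesis f_der : left_derivable f 1.
Let D := left_derive f 1.

Lemma left_quotient_lt_derive (x : R) : 0 <= x < 1 -> left_quotient f 1 x < D.
Proof.
(* Passing to the limit loses strictness, so the midpoint [y] is inserted between [x] and [1]. *)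
move=> /andP[x0 x1]; pose y := (x + 1) / 2.
have xy : x < y by rewrite /y; lra.
have y1 : y < 1 by rewrite /y; lra.
apply: (lt_le_trans (left_quotient_increasing _ _ x0 xy y1)).
apply: limr_ge => //; near=> z.
have yz : y < z by near: z; exact: nbhs_left_gt.
have z1 : z < 1 by near: z; exact: nbhs_left_lt.
by apply/ltW/left_quotient_increasing => //; lra.
Unshelve. all: by end_near. Qed.

(** The chord from [0] to [1] has slope [1]. *)
Lemma left_derive_gt1 : 1 < D.
Proof.
suff <- : left_quotient f 1 0 = 1 by apply: left_quotient_lt_derive; rewrite lexx ltr01.
by rewrite /left_quotient f0 f1 !sub0r divff // oppr_eq0 oner_eq0.
Qed.

Lemma left_quotient_gt c : c < D -> exists2 x, 0 <= x < 1 & c < left_quotient f 1 x.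
Proof.
move=> cD; near (1 : R)^'- => x; exists x.
  by apply/andP; split; near: x; [apply: nbhs_left_ge|apply: nbhs_left_lt].
by near: x; exact: (cvgr_gt D).
Unshelve. all: by end_near. Qed.

(** The chord from [x] to [1] is no steeper than the one from [y], so extending the latter to the
    left stays below the graph. *)
Lemma convex_ge_chord (x y : R) : 0 <= x -> x <= y -> y < 1 ->
  1 - left_quotient f 1 y * (1 - x) <= f x.
Proof.
move=> x0 xy y1; rewrite (left_quotient_convexE _ (le_lt_trans xy y1)).
rewrite lerD2l lerN2 ler_wpM2r ?subr_ge0 ?(ltW (le_lt_trans xy y1)) //.
move: xy; rewrite le_eqVlt => /predU1P[->//|xy].
by rewrite ltW // left_quotient_increasing.
Qed.

Lemma convex_ge_tangent (x : R) : 0 <= x <= 1 -> 1 - D * (1 - x) <= f x.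
Proof.
move=> /andP[x0]; rewrite le_eqVlt => /predU1P[->|x1].
  by rewrite subrr mulr0 subr0 f1.
rewrite (left_quotient_convexE _ x1) lerD2l lerN2 ler_wpM2r ?subr_ge0 ?ltW //.
by rewrite left_quotient_lt_derive // x0.
Qed.

End convex.

(** The table [q n] is final up to index [n], and each step overwrites only larger indices; the
    diagonal collects the final values. *)
Lemma strong_recursion {T : Type} (x0 : T) (g : nat -> (nat -> T) -> T) :
  (forall n u v, (forall k, (k <= n)%N -> u k = v k) -> g n u = g n v) ->
  exists u : nat -> T, u 0%N = x0 /\ forall n, u n.+1 = g n u.
Proof.
move=> gP.
pose q n := iteri n (fun i v k => if (k <= i)%N then v k else g i v) (fun=> x0).
have qE n k : (k <= n)%N -> q n k = q k k.
  elim: n => [|n IH]; first by rewrite leqn0 => /eqP ->.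
  by rewrite leq_eqVlt => /predU1P[->//|]; rewrite ltnS => kn; rewrite /= kn IH.
exists (fun n => q n n); split=> // n.
by rewrite [LHS]/= ltnn; apply: gP => k /qE.
Qed.

(** * The recursion satisfied by the proportions, and its limit *)

Section recursion.
Context {R : realType} (f : R -> R) (phi theta : nat -> R).
Context (lambda alpha : R) (P : nat -> R).
Hypotheses (lambda_gt0 : 0 < lambda) (alpha_gt0 : 0 < alpha).
Hypotheses (phi_distr : proper_distribution phi)
  (theta_distr : proper_distribution theta).
Hypotheses (phi_mean : left_derivable (generating_function phi) 1)
  (theta_mean : left_derivable (generating_function theta) 1).
Hypotheses (f_pos : forall x : R, 0 < x <= 1 -> 0 < f x).
Hypotheses (f_convex : strictly_convex_on 0 1 f) (f0 : f 0 = 0) (f1 : f 1 = 1).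
Hypothesis f_der : left_derivable f 1.
Let b := lambda * left_derive (generating_function phi) 1.
Let a := alpha * left_derive (generating_function theta) 1.
Let D := left_derive f 1.

Lemma lambda_mean_gt0 : 0 < b.
Proof. by rewrite mulr_gt0 // (lt_le_trans ltr01) // mean_ge1. Qed.

Lemma alpha_mean_gt0 : 0 < a.
Proof. by rewrite mulr_gt0 // (lt_le_trans ltr01) // mean_ge1. Qed.

Hypothesis P0 : P 0%N = 0.
Hypothesis P_rec : forall n, (b + a) * P n.+1 =
  lambda * series (survival phi) n.+1 + alpha * convol (survival theta) (f \o P) n.

Let ba_gt0 : 0 < b + a.
Proof. by rewrite addr_gt0 ?lambda_mean_gt0 ?alpha_mean_gt0. Qed.

(** A point with [g(x) <= x] is a barrier: [f] is monotone, and the partial sums of the tails stay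
    below the means. It is used at [x = 1] and, for necessity, at some [x < 1]. *)
Lemma recursion_bounded (x : R) : 0 <= x <= 1 -> b + a * f x <= (b + a) * x ->
  forall n, 0 <= P n <= x.
Proof.
move=> /andP[x0 x1] hx; elim/ltn_ind => -[|n] IH; first by rewrite P0 lexx.
have Pn k : (k <= n)%N -> 0 <= P k <= x by exact: IH.
have th0 := survival_ge0 _ theta_distr.
have fx : 0 <= f x by rewrite (convex_ge0 f) // x0.
apply/andP; split.
  rewrite -(pmulr_rge0 _ ba_gt0) P_rec.
  apply: addr_ge0; apply: mulr_ge0 (ltW _) _ => //.
    by apply: sumr_ge0 => i _; exact: survival_ge0.
  rewrite -[leLHS](mulr0 (series (survival theta) n.+1)) -convol_cst.
  apply: ler_convol => // j /Pn /andP[j0 jx].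
  by rewrite (convex_ge0 f) // j0 (le_trans jx).
rewrite -(ler_pM2l ba_gt0) P_rec; apply: le_trans hx; apply: lerD.
  by rewrite ler_pM2l //; exact: series_survival_le_mean.
apply: (@le_trans _ _ (alpha * convol (survival theta) (fun=> f x) n)).
  rewrite ler_pM2l //; apply: ler_convol => // j /Pn /andP[j0 jx] /=.
  exact: (convex_nondecreasing f).
by rewrite convol_cst mulrA ler_wpM2r // ler_pM2l //; exact: series_survival_le_mean.
Qed.

Lemma recursion_le1 n : 0 <= P n <= 1.
Proof. by apply: recursion_bounded; rewrite ?ler01 ?lexx // f1 !mulr1. Qed.

Lemma recursion_nondecreasing : nondecreasing_seq P.
Proof.
apply/nondecreasing_seqP; elim/ltn_ind => n IH.
case: n IH => [|n] IH; first by rewrite P0; case/andP: (recursion_le1 1).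
rewrite -(ler_pM2l ba_gt0) !P_rec -subr_ge0.
(* [w] holds the increments of [f \o P]. The difference of the two convolutions is the convolution
   with [w], whose terms up to [n + 1] are non-negative by induction. *)
pose w k := if k is k'.+1 then f (P k) - f (P k') else 0.
have := convol_increment (survival theta) (f \o P) w n.
rewrite /= P0 f0 => /(_ erefl erefl (fun=> erefl)) wE.
rewrite opprD addrACA -!mulrBr -wE.
rewrite addr_ge0 ?mulr_ge0 ?(ltW lambda_gt0) ?(ltW alpha_gt0) //.
  by rewrite seriesSr addrAC subrr add0r survival_ge0.
rewrite -[leLHS](mulr0 (series (survival theta) n.+2)) -convol_cst.
apply: ler_convol => [i|[|k] kn]; rewrite ?survival_ge0 //= subr_ge0.
apply: (convex_nondecreasing f) => //; last by case/andP: (recursion_le1 k.+1).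
- by case/andP: (recursion_le1 k).
- exact: IH.
Qed.

Lemma recursion_nondecreasing_comp : nondecreasing_seq (f \o P).
Proof.
move=> n m nm /=; have [/andP[n0 _] /andP[_ m1]] := (recursion_le1 n, recursion_le1 m).
by apply: (convex_nondecreasing f) => //; exact: recursion_nondecreasing.
Qed.

Lemma recursion_comp_ge0 n : 0 <= (f \o P) n.
Proof. by apply: (convex_ge0 f) => //; exact: recursion_le1. Qed.

(** The limit is taken on both sides of the recursion. Keeping [l] apart from [f p] avoids any
    appeal to continuity of [f] at [p]. *)
Lemma recursion_lim_comp (p l : R) : P @ \oo --> p -> f \o P @ \oo --> l ->
  (b + a) * p = b + a * l.
Proof.
move=> Pp fl.
have L : (fun n => (b + a) * P n.+1) @ \oo --> (b + a) * p.
  apply: cvgMl_tmp.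
  by have : [sequence P n.+1]_n @ \oo --> p by rewrite cvg_shiftS.
have M : (fun n => (b + a) * P n.+1) @ \oo --> b + a * l.
  under eq_fun do rewrite P_rec.
  rewrite /b /a -mulrA; apply: cvgD; apply: cvgMl_tmp.
    have : series (survival phi) @ \oo --> left_derive (generating_function phi) 1.
      exact: cvg_series_survival.
    by rewrite -cvg_shiftS.
  apply: cvg_convol => //; first exact: survival_ge0.
  - exact: cvg_series_survival.
  - exact: recursion_comp_ge0.
  - exact: recursion_nondecreasing_comp.
exact: (cvg_unique _ L M).
Qed.

Lemma recursion_cvg1 : a * D <= b + a -> P @ \oo --> (1 : R).
Proof.
move=> aD.
have Pc : cvgn P.
  apply: nondecreasing_is_cvgn; first exact: recursion_nondecreasing.
  by exists 1 => _ [n _ <-]; case/andP: (recursion_le1 n).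
have fc : cvgn (f \o P).
  apply: nondecreasing_is_cvgn; first exact: recursion_nondecreasing_comp.
  exists 1 => _ [n _ <-] /=; rewrite -f1.
  by case/andP: (recursion_le1 n) => *; apply: (convex_nondecreasing f).
have lE := recursion_lim_comp _ _ Pc fc.
set p := limn P in Pc lE; set l := limn _ in fc lE.
have Ple n : P n <= p.
  by apply: nondecreasing_cvgn_le => //; exact: recursion_nondecreasing.
have p0 : 0 <= p by rewrite -P0.
have p1 : p <= 1.
  by apply: limr_le => //; apply: nearW => n; case/andP: (recursion_le1 n).
have [<- //|pn1] := eqVneq p 1.
have {}p1 : p < 1 by rewrite lt_neqAle pn1.
(* A chord bound replaces left continuity of [f] at [p]. *)
set s := left_quotient f 1 p.
have sl : 1 - s * (1 - p) <= l.
  have h : (fun n => 1 - s * (1 - P n)) @ \oo --> 1 - s * (1 - p).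
    apply: cvgB; first exact: cvg_cst.
    by apply: cvgMl_tmp; apply: cvgB => //; exact: cvg_cst.
  apply: (ler_cvg_to h fc); apply: nearW => n.
  apply: (convex_ge_chord f) => //; by case/andP: (recursion_le1 n).
have sD : s < D by apply: left_quotient_lt_derive => //; rewrite p0.
have a0 := alpha_mean_gt0.
(* If [p < 1], then [(b + a)(1 - p) = a (1 - l) <= a s (1 - p) < a D (1 - p) <= (b + a)(1 - p)],
   which is absurd. *)
suff : (b + a) * (1 - p) < (b + a) * (1 - p) by rewrite ltxx.
have p1' : 0 < 1 - p by rewrite subr_gt0.
apply: (@le_lt_trans _ _ (a * s * (1 - p))).
  have : a * (1 - s * (1 - p)) <= a * l by rewrite ler_pM2l.
  by move: lE; lra.
by apply: (lt_le_trans _ (ler_wpM2r (ltW p1') aD)); rewrite ltr_pM2r // ltr_pM2l.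
Qed.

(** [f] is squeezed between its tangent at [1] and the constant [1]. *)
Lemma recursion_comp_cvg1 : P @ \oo --> (1 : R) -> f \o P @ \oo --> (1 : R).
Proof.
move=> Pc; apply: (@squeeze_cvgr _ _ _ _ (fun n => 1 - D * (1 - P n)) (fun=> 1)).
- apply: nearW => n; rewrite (convex_ge_tangent f) ?recursion_le1 //= -f1.
  by case/andP: (recursion_le1 n) => *; apply: (convex_nondecreasing f).
- rewrite -[X in _ --> X]subr0 -(mulr0 D) -(subrr 1).
  apply: cvgB; first exact: cvg_cst.
  by apply: cvgMl_tmp; apply: cvgB => //; exact: cvg_cst.
- exact: cvg_cst.
Qed.

(** Otherwise some chord from [x < 1] has slope above [(b + a) / a]. Then [g(x) <= x], and [x] is a
    barrier keeping [P] away from [1]. *)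
Lemma recursion_cvg1_le : P @ \oo --> (1 : R) -> a * D <= b + a.
Proof.
move=> Pc; have a0 := alpha_mean_gt0; rewrite leNgt; apply/negP => h.
have [|x /andP[x0 x1] hx] := left_quotient_gt f f_der ((b + a) / a).
  by rewrite ltr_pdivrMr // mulrC.
have x01 : 0 <= x <= 1 by rewrite x0 ltW.
have fx : b + a * f x <= (b + a) * x.
  move: hx; rewrite ltr_pdivrMr // (left_quotient_convexE f) // -subr_gt0 => hx.
  have x1' : 0 < 1 - x by rewrite subr_gt0.
  by rewrite -subr_ge0; apply: le_trans (ltW (mulr_gt0 hx x1')) _; lra.
have Px : 1 <= x.
  apply: (cvgr_to_le Pc); apply: nearW => n.
  by have /andP[] := recursion_bounded x x01 fx n.
by move: (lt_le_trans x1 Px); rewrite ltxx.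
Qed.

End recursion.

(** * Partial sums and stationary regimes *)

Lemma partial_sum0 {R : realType} (r : nat -> R) : partial_sum r 0 = 0.
Proof. by rewrite /partial_sum big_geq. Qed.

Lemma partial_sumS {R : realType} (r : nat -> R) n :
  partial_sum r n.+1 = partial_sum r n + r n.+1.
Proof. by rewrite /partial_sum big_nat_recr. Qed.

Lemma partial_sum_policy {R : realType} (f : R -> R) (r : nat -> R) :
  f 0 = 0 -> partial_sum (policy f r) = f \o proportion r.
Proof.
move=> f0; apply/funext; elim=> [|n IH] /=.
  by rewrite partial_sum0 /proportion partial_sum0 mul0r f0.
by rewrite partial_sumS IH /= addrC subrK.
Qed.

Section stationary.
Context {R : realType} (f : R -> R) (phi theta : nat -> R) (lambda mu alpha : R).
Hypotheses (f0 : f 0 = 0) (phi0 : phi 0%N = 0).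

(* [flux r n - mu * r 1] is the growth rate of [r 1 + ... + r n]. *)
Definition flux (r : nat -> R) (n : nat) : R :=
  lambda * series phi n.+1 + mu * r n.+1 +
  alpha * (convol theta (f \o proportion r) n - f (proportion r n)).

Lemma drift_policyE (r : nat -> R) n :
  drift lambda mu alpha phi theta (policy f) r n.+1 = flux r n.+1 - flux r n.
Proof.
have P0 : f (proportion r 0) = 0 by rewrite /proportion partial_sum0 mul0r.
rewrite /drift -/(convol theta (policy f r) n.+1).
rewrite (convol_increment theta (f \o proportion r) (policy f r)) //=.
by rewrite /flux [series phi n.+2]seriesSr; ring.
Qed.

(** A constant path has zero derivative, so the drift, a difference of consecutive fluxes, vanishes.
    The flux is then constant, with the value it has at [n = 0]. *)
Lemma stationary_regimeP (r : nat -> R) :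
  stationary_regime lambda mu alpha phi theta (policy f) r <->
  (forall i, 0 <= r i.+1) /\ (forall n, flux r n = mu * r 1%N).
Proof.
have P0 : f (proportion r 0) = 0 by rewrite /proportion partial_sum0 mul0r.
have flux0 : flux r 0 = mu * r 1%N.
  by rewrite /flux /convol /series /= !big_nat1 /= P0 phi0; ring.
split=> [st|[r0 fl] t [//|i] t0 _].
  split=> [i|n]; first by have [] := st 1 i.+1 ltr01 isT.
  elim: n => // n <-; have [_ h] := st 1 n.+1 ltr01 isT.
  apply: subr0_eq; rewrite -drift_policyE -(derive_val (is_derive := h)).
  exact: derive_cst.
split; first exact: r0.
by rewrite drift_policyE !fl subrr; exact: is_derive_cst.
Qed.

End stationary.

(** * Ergodicity as convergence of the recursion to 1 *)

Section ergodicity.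
Context {R : realType} (lambda mu alpha : R) (phi theta : nat -> R) (f : R -> R).
Hypotheses (lambda_gt0 : 0 < lambda) (mu_gt0 : 0 < mu) (alpha_gt0 : 0 < alpha).
Hypotheses (phi_distr : proper_distribution phi)
  (theta_distr : proper_distribution theta).
Hypotheses (phi_mean : left_derivable (generating_function phi) 1)
  (theta_mean : left_derivable (generating_function theta) 1).
Hypotheses (f_pos : forall x : R, 0 < x <= 1 -> 0 < f x).
Hypotheses (f_convex : strictly_convex_on 0 1 f) (f0 : f 0 = 0) (f1 : f 1 = 1).
Hypothesis f_der : left_derivable f 1.
Let b := lambda * left_derive (generating_function phi) 1.
Let a := alpha * left_derive (generating_function theta) 1.

Lemma ergodic_recursion : ergodic lambda mu alpha phi theta (policy f) ->
  exists P : nat -> R, [/\ P 0%N = 0,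
    (forall n, (b + a) * P n.+1 =
      lambda * series (survival phi) n.+1 +
      alpha * convol (survival theta) (f \o P) n) &
    P @ \oo --> (1 : R)].
Proof.
have phi0 : phi 0%N = 0 by case: phi_distr.
move=> [r [/(stationary_regimeP _ _ _ _ _ _ f0 phi0) [r0 fl] Sc pi1]].
have P0 : proportion r 0 = 0 by rewrite /proportion partial_sum0 mul0r.
have {}pi1 : f \o proportion r @ \oo --> (1 : R).
  by rewrite partial_sum_policy in pi1.
set T := Defs.total r; have ST : partial_sum r @ \oo --> T by [].
have Smono : nondecreasing_seq (partial_sum r).
  by apply/nondecreasing_seqP => n; rewrite partial_sumS lerDl.
have Sge0 n : 0 <= partial_sum r n by rewrite -(partial_sum0 r) Smono.
have Sle n : partial_sum r n <= T by apply: nondecreasing_cvgn_le.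
(* With total [0], the convention [0^-1 = 0] makes all proportions [0], so the policy could not sum
   to [1]. *)
have T0 : 0 < T.
  rewrite lt_neqAle (le_trans (Sge0 0%N)) // andbT; apply/negP => /eqP T0.
  have : f \o proportion r = fun=> 0.
    by apply/funext => n /=; rewrite /proportion -/T -T0 invr0 mulr0.
  move=> fE; move: pi1; rewrite fE => /(cvg_unique (@Rhausdorff R) (cvg_cst 0)).
  by move/eqP; rewrite eq_sym oner_eq0.
have Ple n : 0 <= proportion r n <= 1.
  by rewrite /proportion divr_ge0 ?(ltW T0) //= ler_pdivrMr // mul1r.
have Fmono : nondecreasing_seq (f \o proportion r).
  move=> n m nm /=; have [/andP[n0 _] /andP[_ m1]] := (Ple n, Ple m).
  by apply: (convex_nondecreasing f) => //; rewrite ler_pM2r ?invr_gt0 // Smono.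
have Fge0 n : 0 <= (f \o proportion r) n by exact: (convex_ge0 f).
have rcvg : (fun n => r n.+1) @ \oo --> 0.
  have -> : (fun n => r n.+1) = fun n => partial_sum r n.+1 - partial_sum r n.
    by apply/funext => n; rewrite partial_sumS addrC addKr.
  rewrite -(subrr T); apply: cvgB => //.
  by have : [sequence partial_sum r n.+1]_n @ \oo --> T by rewrite cvg_shiftS.
(* The constant flux equals its limit, in which [r n] vanishes and the two visit terms cancel. *)
have r1 : mu * r 1%N = lambda.
  have L : flux f phi theta lambda mu alpha r @ \oo -->
      lambda * 1 + mu * 0 + alpha * (1 * 1 - 1).
    apply: cvgD; first apply: cvgD; apply: cvgMl_tmp => //.
      have : [sequence series phi n.+1]_n @ \oo --> (1 : R).
        by rewrite cvg_shiftS; case: phi_distr.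
      by [].
    apply: cvgB => //; case: theta_distr => _ th0 th1.
    exact: cvg_convol.
  have := cvg_unique (@Rhausdorff R) L.
  have -> : flux f phi theta lambda mu alpha r = fun=> mu * r 1%N by apply/funext.
  by move=> /(_ _ _ (cvg_cst _)) <-; ring.
(* Summed balance equations: constancy of the flux gives [mu * r (n + 2)], and [convol_survival]
   matches it with the increment of the right-hand side. *)
have S_rec n : mu * partial_sum r n.+1 =
    lambda * series (survival phi) n.+1 +
    alpha * convol (survival theta) (f \o proportion r) n.
  elim: n => [|n IH]; rewrite partial_sumS mulrDr.
    rewrite partial_sum0 mulr0 add0r r1 /series /convol /= !big_nat1 /= P0 f0.
    by rewrite /survival /series /= big_nat1 phi0; ring.
  have := fl n.+1; rewrite r1 IH [series _ n.+2]seriesSr convol_survival /flux /=.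
  have -> : survival phi n.+1 = 1 - series phi n.+2 by [].
  lra.
(* As [n] tends to infinity, the summed equations fix the total. *)
have TE : mu * T = b + a.
  have L : (fun n => mu * partial_sum r n.+1) @ \oo --> mu * T.
    apply: cvgMl_tmp.
    by have : [sequence partial_sum r n.+1]_n @ \oo --> T by rewrite cvg_shiftS.
  apply: (cvg_unique (@Rhausdorff R) L); rewrite (funext S_rec).
  rewrite /b /a; apply: cvgD; apply: cvgMl_tmp.
    have : series (survival phi) @ \oo --> left_derive (generating_function phi) 1.
      exact: cvg_series_survival.
    by rewrite -cvg_shiftS.
  rewrite -[X in _ --> X]mulr1; apply: cvg_convol => //; first exact: survival_ge0.
  exact: cvg_series_survival.
exists (proportion r); split => //.
  by move=> n; rewrite -S_rec -TE /proportion -/T -mulrA [T * _]mulrC divfK // gt_eqF.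
rewrite -[X in _ --> X](divff (lt0r_neq0 T0)); apply: cvgMr_tmp; exact: ST.
Qed.

Lemma recursion_ergodic (P : nat -> R) : P 0%N = 0 ->
  (forall n, (b + a) * P n.+1 =
    lambda * series (survival phi) n.+1 + alpha * convol (survival theta) (f \o P) n) ->
  P @ \oo --> (1 : R) -> ergodic lambda mu alpha phi theta (policy f).
Proof.
move=> P0 P_rec P1.
have phi0 : phi 0%N = 0 by case: phi_distr.
have ba0 : 0 < b + a by rewrite addr_gt0 ?lambda_mean_gt0 ?alpha_mean_gt0.
(* The total is the value forced by the balance equations, and [r] is the increment of [T * P];
   since [0.-1 = 0], the dummy value [r 0] is [0]. *)
pose T := (b + a) / mu; have T0 : 0 < T by rewrite divr_gt0.
pose r i := T * (P i - P i.-1).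
have SE n : partial_sum r n = T * P n.
  elim: n => [|n IH]; first by rewrite partial_sum0 P0 mulr0.
  by rewrite partial_sumS IH /r /=; ring.
have Sc : partial_sum r @ \oo --> T.
  have -> : partial_sum r = fun n => T * P n by apply/funext.
  by rewrite -[X in _ --> X]mulr1; apply: cvgMl_tmp.
have PE : proportion r = P.
  apply/funext => n; rewrite /proportion /Defs.total (cvg_lim _ Sc) // SE.
  by rewrite mulrC mulKf // gt_eqF.
exists r; split.
- apply/(stationary_regimeP _ _ _ _ _ _ f0 phi0).
  have fl n : flux f phi theta lambda mu alpha r n = lambda.
    rewrite /flux PE /r /= /T.
    have -> : mu * ((b + a) / mu * (P n.+1 - P n)) = (b + a) * P n.+1 - (b + a) * P n.
      by field; rewrite gt_eqF.
    (* At [n = 0] the term [P n] is the initial value; the recursion expands it only for larger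
       [n]. *)
    rewrite P_rec; case: n => [|n].
      rewrite P0 /series /convol /= !big_nat1 /= P0 f0.
      rewrite /survival /series /= !big_nat1 phi0.
      by ring.
    rewrite P_rec [series (survival _) n.+2]seriesSr convol_survival /=.
    have -> : survival phi n.+1 = 1 - series phi n.+2 by [].
    ring.
  split=> [i|n]; last first.
    rewrite fl -(fl 0%N) /flux /convol /series /= !big_nat1 PE /= P0 f0 phi0.
    ring.
  rewrite mulr_ge0 ?(ltW T0) // subr_ge0.
  by apply: (recursion_nondecreasing f phi theta lambda alpha P).
- by apply/cvg_ex; exists T.
- rewrite partial_sum_policy // PE.
  by apply: (recursion_comp_cvg1 f phi theta lambda alpha P).
Qed.

Lemma ergodicP : ergodic lambda mu alpha phi theta (policy f) <->
  a * left_derive f 1 <= b + a.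
Proof.
split=> [/ergodic_recursion[P [P0 P_rec P1]]|aD].
  by apply: (recursion_cvg1_le f phi theta lambda alpha P).
(* The recursion solved for [P (n + 1)]; the convolution reads [u] only at indices [n - i <= n], as
   [strong_recursion] requires. *)
pose g n u := (lambda * series (survival phi) n.+1 +
  alpha * convol (survival theta) (f \o u) n) / (b + a).
have [|P [P0 PS]] := strong_recursion 0 g.
  move=> n u v uv; rewrite /g; congr ((_ + _ * _) / _).
  by apply: eq_bigr => i _ /=; rewrite uv // leq_subr.
have ba0 : 0 < b + a by rewrite addr_gt0 ?lambda_mean_gt0 ?alpha_mean_gt0.
have P_rec n : (b + a) * P n.+1 =
    lambda * series (survival phi) n.+1 + alpha * convol (survival theta) (f \o P) n.
  by rewrite PS /g mulrC divfK // gt_eqF.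
apply: (recursion_ergodic P) => //.
exact: (recursion_cvg1 f phi theta lambda alpha P).
Qed.

End ergodicity.

Theorem theorem3p5 (R : realType) (lambda mu alpha : R) (phi theta : nat -> R)
    (f : R -> R)
    (lambda_gt0 : 0 < lambda) (mu_gt0 : 0 < mu) (alpha_gt0 : 0 < alpha)
    (phi_distr : proper_distribution phi)
    (theta_distr : proper_distribution theta)
    (phi_mean : left_derivable (generating_function phi) 1)
    (theta_mean : left_derivable (generating_function theta) 1)
    (f_pos : forall x : R, 0 < x <= 1 -> 0 < f x)
    (f_convex : strictly_convex_on 0 1 f)
    (f0 : f 0 = 0) (f1 : f 1 = 1)
    (f_der : left_derivable f 1) :
  1 < left_derive f 1 /\
  (ergodic lambda mu alpha phi theta (policy f) <->
   alpha * left_derive (generating_function theta) 1 /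
     (lambda * left_derive (generating_function phi) 1)
   <= 1 / (left_derive f 1 - 1)).
Proof.
have D1 := left_derive_gt1 f f_convex f0 f1 f_der.
split => //; rewrite ergodicP //.
set D := left_derive f 1 in D1 *.
set b := lambda * _; set a := alpha * _.
have b0 : 0 < b by exact: lambda_mean_gt0.
(* Since [b > 0] and [D > 1], clearing denominators gives [a (D - 1) <= b]. *)
rewrite ler_pdivrMr // mul1r [_^-1 * _]mulrC ler_pdivlMr ?subr_gt0 //.
by rewrite mulrBr mulr1 lerBlDr.
Qed.
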